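(* Let $a=1+a_2\mathbf j+a_3\mathbf k$ with $a_2,a_3\in\mathbb R$, $a_2^2+a_3^2=1$, let $b=b_1\mathbf i+b_2\mathbf j+b_3\mathbf k\ne0$ and $c\in\mathbb H_s$, and assume $P_{ab}\ne0$. Let $T$ be a real solution of the cubic equation $$4P_{ab}^2T^3+[4P_{ab}(2P_{ac}+I_b)]T^2+[4P_{ab}P_{bc}+(2P_{ac}+I_b)^2]T+2P_{bc}(2P_{ac}+I_b)-2P_{ab}I_c=0$$ such that $Ta+b\notin Z(\mathbb H_s)$, and let $$N=\frac{2P_{ab}T^2+(2P_{ac}+I_b)T+2P_{bc}}{2P_{ab}}.$$ Then $x=(Ta+b)^{-1}(aN-c)$ is a solution of the equation $ax^2+bx+c=0$.
   Context: $\mathbb H_s$ is the split quaternion algebra: the 4-dimensional associative real algebra with basis $1,\mathbf i,\mathbf j,\mathbf k$ and $\mathbf i^2=-1$, $\mathbf j^2=\mathbf k^2=1$, $\mathbf i\mathbf j=\mathbf k=-\mathbf j\mathbf i$, $\mathbf j\mathbf k=-\mathbf i=-\mathbf k\mathbf j$, $\mathbf k\mathbf i=\mathbf j=-\mathbf i\mathbf k$. For $x=x_0+x_1\mathbf i+x_2\mathbf j+x_3\mathbf k$ and $y=y_0+y_1\mathbf i+y_2\mathbf j+y_3\mathbf k$ with real coefficients: $\bar x=x_0-x_1\mathbf i-x_2\mathbf j-x_3\mathbf k$, $P_{xy}=\langle x,y\rangle=x_0y_0+x_1y_1-x_2y_2-x_3y_3$, $I_x=\langle x,x\rangle=\bar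 xx$, $Z(\mathbb H_s)=\{x\in\mathbb H_s:I_x=0\}$. An element $x$ is invertible iff $I_x\ne0$, and then $x^{-1}=\bar x/I_x$. *)

(* Defs.v *)
From HB Require Import structures.
From mathcomp Require Import all_boot all_order all_algebra.
From mathcomp Require Import ring.

Set Implicit Arguments.
Unset Strict Implicit.
Unset Printing Implicit Defensive.

Import GRing.Theory.
Local Open Scope ring_scope.

Record splitquat (R : Type) : Type :=
  SQuat { sq0 : R; sq1 : R; sq2 : R; sq3 : R }.

Section Choice.
Variable R : Type.

Definition squat_to_prod (x : splitquat R) := (sq0 x, sq1 x, sq2 x, sq3 x).
Definition squat_of_prod (t : R * R * R * R) :=
  let: (x0, x1, x2, x3) := t in SQuat x0 x1 x2 x3.

Lemma squat_to_prodK : cancel squat_to_prod squat_of_prod.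
Proof. by case. Qed.

End Choice.

HB.instance Definition _ (R : eqType) :=
  Equality.copy (splitquat R) (can_type (@squat_to_prodK R)).
HB.instance Definition _ (R : choiceType) :=
  Choice.copy (splitquat R) (can_type (@squat_to_prodK R)).

Section Algebra.
Variable R : fieldType.
Implicit Types (x y z : splitquat R) (r : R).

Definition sqzero : splitquat R := SQuat 0 0 0 0.
Definition sqone : splitquat R := SQuat 1 0 0 0.
Definition sqopp x := SQuat (- sq0 x) (- sq1 x) (- sq2 x) (- sq3 x).
Definition sqadd x y :=
  SQuat (sq0 x + sq0 y) (sq1 x + sq1 y) (sq2 x + sq2 y) (sq3 x + sq3 y).
Definition sqscale r x := SQuat (r * sq0 x) (r * sq1 x) (r * sq2 x) (r * sq3 x).

(* The R-bilinear extension of i^2 = -1, j^2 = k^2 = 1, ij = k = -ji,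
   jk = -i = -kj, ki = j = -ik; see the table sqii ... sqik below. *)
Definition sqmul x y :=
  let: SQuat x0 x1 x2 x3 := x in
  let: SQuat y0 y1 y2 y3 := y in
  SQuat (x0 * y0 - x1 * y1 + x2 * y2 + x3 * y3)
        (x0 * y1 + x1 * y0 - x2 * y3 + x3 * y2)
        (x0 * y2 + x2 * y0 - x1 * y3 + x3 * y1)
        (x0 * y3 + x3 * y0 + x1 * y2 - x2 * y1).

Fact sqaddA : associative sqadd.
Proof. by move=> x y z; rewrite /sqadd /= !addrA. Qed.
Fact sqaddC : commutative sqadd.
Proof. by move=> x y; rewrite /sqadd; congr SQuat; exact: addrC. Qed.
Fact sqadd0 : left_id sqzero sqadd.
Proof. by case=> *; rewrite /sqadd /= !add0r. Qed.
Fact sqaddN : left_inverse sqzero sqopp sqadd.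
Proof. by case=> *; rewrite /sqadd /= !addNr. Qed.

HB.instance Definition _ :=
  GRing.isZmodule.Build (splitquat R) sqaddA sqaddC sqadd0 sqaddN.

Fact sqmulA : associative sqmul.
Proof. by case=> ? ? ? ? [? ? ? ?] [? ? ? ?] /=; congr SQuat; ring. Qed.
Fact sqmul1l : left_id sqone sqmul.
Proof. by case=> ? ? ? ? /=; congr SQuat; ring. Qed.
Fact sqmul1r : right_id sqone sqmul.
Proof. by case=> ? ? ? ? /=; congr SQuat; ring. Qed.
Fact sqmulDl : left_distributive sqmul +%R.
Proof. by case=> ? ? ? ? [? ? ? ?] [? ? ? ?] /=; congr SQuat => /=; ring. Qed.
Fact sqmulDr : right_distributive sqmul +%R.
Proof. by case=> ? ? ? ? [? ? ? ?] [? ? ? ?] /=; congr SQuat => /=; ring. Qed.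
Fact sqone_neq0 : sqone != 0.
Proof. by apply/eqP=> -[/eqP]; rewrite oner_eq0. Qed.

HB.instance Definition _ := GRing.Zmodule_isNzRing.Build (splitquat R)
  sqmulA sqmul1l sqmul1r sqmulDl sqmulDr sqone_neq0.

Fact sqscaleA r s x : sqscale r (sqscale s x) = sqscale (r * s) x.
Proof. by rewrite /sqscale /= !mulrA. Qed.
Fact sqscale1 : left_id 1 sqscale.
Proof. by case=> *; rewrite /sqscale /= !mul1r. Qed.
Fact sqscaleDr : right_distributive sqscale +%R.
Proof. by move=> r x y; congr SQuat; exact: mulrDr. Qed.
Fact sqscaleDl x : {morph sqscale^~ x : r s / r + s}.
Proof. by move=> r s; congr SQuat; exact: mulrDl. Qed.

HB.instance Definition _ := GRing.Zmodule_isLmodule.Build R (splitquat R)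
  sqscaleA sqscale1 sqscaleDr sqscaleDl.

Fact sqscaleAl r x y : r *: (x * y) = (r *: x) * y.
Proof. by case: x y => ? ? ? ? [? ? ? ?]; congr SQuat => /=; ring. Qed.

HB.instance Definition _ :=
  GRing.Lmodule_isLalgebra.Build R (splitquat R) sqscaleAl.

Fact sqscaleAr r x y : r *: (x * y) = x * (r *: y).
Proof. by case: x y => ? ? ? ? [? ? ? ?]; congr SQuat => /=; ring. Qed.

HB.instance Definition _ :=
  GRing.Lalgebra_isAlgebra.Build R (splitquat R) sqscaleAr.

Definition sqi : splitquat R := SQuat 0 1 0 0.
Definition sqj : splitquat R := SQuat 0 0 1 0.
Definition sqk : splitquat R := SQuat 0 0 0 1.

Definition sqconj x := SQuat (sq0 x) (- sq1 x) (- sq2 x) (- sq3 x).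

(* The form written P_xy or <x, y>, of signature (2, 2); sqI is its quadratic
   form I_x and sqZ the set Z of its null vectors. *)
Definition sqP x y : R :=
  sq0 x * sq0 y + sq1 x * sq1 y - sq2 x * sq2 y - sq3 x * sq3 y.

Definition sqI x : R := sqP x x.

Definition sqZ : {pred splitquat R} := [pred x | sqI x == 0].

Lemma sqconj_mull x : sqconj x * x = (sqI x)%:A.
Proof. by case: x => ? ? ? ?; congr SQuat => /=; rewrite /sqI /sqP /=; ring. Qed.

Lemma sqconj_mulr x : x * sqconj x = (sqI x)%:A.
Proof. by case: x => ? ? ? ?; congr SQuat => /=; rewrite /sqI /sqP /=; ring. Qed.

Lemma sqI_mul x y : sqI (x * y) = sqI x * sqI y.
Proof. by case: x y => ? ? ? ? [? ? ? ?]; rewrite /sqI /sqP /=; ring. Qed.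

(* As everywhere in the ring hierarchy, the inverse is extended by x^-1 = x on
   non-units. *)
Definition squnit : {pred splitquat R} := [pred x | x \notin sqZ].
Definition sqinv x := if x \in squnit then (sqI x)^-1 *: sqconj x else x.

Fact sqmulVx : {in squnit, left_inverse 1 sqinv *%R}.
Proof.
move=> x ux; rewrite /sqinv ux -scalerAl sqconj_mull scalerA mulVf ?scale1r //.
Qed.
Fact sqmulxV : {in squnit, right_inverse 1 sqinv *%R}.
Proof.
move=> x ux; rewrite /sqinv ux -scalerAr sqconj_mulr scalerA mulVf ?scale1r //.
Qed.
Fact squnitP x y : y * x = 1 /\ x * y = 1 -> x \in squnit.
Proof.
case=> /(congr1 sqI); rewrite sqI_mul => yx1 _; apply/negP => /eqP Ix0.
move/eqP: yx1; rewrite Ix0 mulr0 eq_sym /sqI /sqP /=.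
by rewrite !mulr0 !mulr1 !subr0 addr0 oner_eq0.
Qed.
Fact sqinv_out : {in [predC squnit], sqinv =1 id}.
Proof. by move=> x /negbTE ux; rewrite /sqinv ux. Qed.

HB.instance Definition _ := GRing.NzRing_hasMulInverse.Build (splitquat R)
  sqmulVx sqmulxV squnitP sqinv_out.

Lemma squnitE x : (x \in GRing.unit) = (x \notin sqZ).
Proof. by []. Qed.

Lemma sqinvE x : x \notin sqZ -> x^-1 = (sqI x)^-1 *: sqconj x.
Proof. by move=> ux; rewrite -[x^-1]/(sqinv x) /sqinv inE ux. Qed.

Lemma squatE x : x = (sq0 x)%:A + sq1 x *: sqi + sq2 x *: sqj + sq3 x *: sqk.
Proof. by case: x => ? ? ? ?; congr SQuat => /=; ring. Qed.

Lemma sqii : sqi * sqi = -1. Proof. by congr SQuat => /=; ring. Qed.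
Lemma sqjj : sqj * sqj = 1. Proof. by congr SQuat => /=; ring. Qed.
Lemma sqkk : sqk * sqk = 1. Proof. by congr SQuat => /=; ring. Qed.
Lemma sqij : sqi * sqj = sqk. Proof. by congr SQuat => /=; ring. Qed.
Lemma sqji : sqj * sqi = - sqk. Proof. by congr SQuat => /=; ring. Qed.
Lemma sqjk : sqj * sqk = - sqi. Proof. by congr SQuat => /=; ring. Qed.
Lemma sqkj : sqk * sqj = sqi. Proof. by congr SQuat => /=; ring. Qed.
Lemma sqki : sqk * sqi = sqj. Proof. by congr SQuat => /=; ring. Qed.
Lemma sqik : sqi * sqk = - sqj. Proof. by congr SQuat => /=; ring. Qed.

End Algebra.

Arguments sqi {R}.
Arguments sqj {R}.
Arguments sqk {R}.
Arguments sqZ {R}.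

(* Main.v *)
Require Import Defs.
From mathcomp Require Import all_boot all_order all_algebra reals.
From mathcomp Require Import ring.
Import GRing.Theory.
Local Open Scope ring_scope.

(** Every split quaternion satisfies its characteristic equation
    x^2 = t x - n, where t = 2 Re x is the trace and n = I_x the norm.
    Substituting it turns a x^2 + b x + c = 0 into the linear equation
    (t a + b) x = n a - c.  The element x = (T a + b)^-1 (N a - c) solves this
    linear equation with T and N in place of t and n, so it is enough to show
    that T and N really are the trace and the norm of x.

    Put D = T a + b.  The trace of x is 2 <D, N a - c> / I_D and, the form I
    being multiplicative, its norm is I_(N a - c) / I_D.  Because
    I_a = 1 - a2^2 - a3^2 = 0, these expand to
      trace: 2 (N P_ab - T P_ac - P_bc) / (2 T P_ab + I_b),
      norm:  (I_c - 2 N P_ac) / (2 T P_ab + I_b).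
    The trace equals T precisely when
      2 P_ab N = 2 P_ab T^2 + (2 P_ac + I_b) T + 2 P_bc,
    which is the definition of N; the norm equals N precisely when
      N (2 P_ab T + 2 P_ac + I_b) = I_c,
    and the cubic is what remains of this after eliminating N.  The facts about
    T and N are [trace_candidate] and [norm_candidate]; the reduction to the
    linear equation is [quadratic_of_linear]. *)

Section TraceNorm.
Variable R : fieldType.
Implicit Types (a b c x y : splitquat R) (r s t n : R).

(** The Cayley-Hamilton identity: it is x times (x + conj x - 2 Re x) = 0. *)
Lemma sq_sqr_trace_norm x : x ^+ 2 = (2 * sq0 x) *: x - (sqI x)%:A.
Proof. by case: x => *; congr SQuat => /=; rewrite /sqI /sqP /=; ring. Qed.

Lemma quadratic_of_linear a b c x :
  ((2 * sq0 x) *: a + b) * x = sqI x *: a - c -> a * x ^+ 2 + b * x + c = 0.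
Proof.
rewrite mulrDl -scalerAl => lin.
rewrite sq_sqr_trace_norm mulrBr -!scalerAr mulr1 (addrAC _ (- _) (b * x)) lin.
by rewrite addrAC subrK subrr.
Qed.

Lemma sq0_invM x y : x \notin sqZ -> sq0 (x^-1 * y) = sqP x y / sqI x.
Proof.
move=> ux; rewrite sqinvE // mulrC; case: x y {ux} => ? ? ? ? [? ? ? ?].
by rewrite /sqI /sqP /=; ring.
Qed.

Lemma sqI_invM x y : x \notin sqZ -> sqI (x^-1 * y) = sqI y / sqI x.
Proof.
move=> ux; apply: (mulfI ux).
by rewrite -sqI_mul mulVKr ?squnitE // mulrC divfK.
Qed.

Lemma sqP_linear_pencil a b c r s :
  sqP (r *: a + b) (s *: a - c)
    = r * s * sqI a - r * sqP a c + s * sqP a b - sqP b c.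
Proof. by case: a b c => ? ? ? ? [? ? ? ?] [? ? ? ?]; rewrite /sqI /sqP /=; ring. Qed.

Lemma sqI_scaleD a b r :
  sqI (r *: a + b) = r ^+ 2 * sqI a + 2 * r * sqP a b + sqI b.
Proof. by case: a b => ? ? ? ? [? ? ? ?]; rewrite /sqI /sqP /=; ring. Qed.

Lemma sqI_scaleB a c r :
  sqI (r *: a - c) = r ^+ 2 * sqI a - 2 * r * sqP a c + sqI c.
Proof. by case: a c => ? ? ? ? [? ? ? ?]; rewrite /sqI /sqP /=; ring. Qed.

(** The first consistency condition: the equation that determines n says
    that t is the trace of the candidate. *)
Lemma trace_candidate a b c t n :
    sqI a = 0 -> t *: a + b \notin sqZ ->
    2 * sqP a b * n
      = 2 * sqP a b * t ^+ 2 + (2 * sqP a c + sqI b) * t + 2 * sqP b c ->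
  2 * sq0 ((t *: a + b)^-1 * (n *: a - c)) = t.
Proof.
move=> Ia uD defn; rewrite sq0_invM // mulrA; apply: (canLR (mulfK uD)).
by rewrite sqP_linear_pencil sqI_scaleD Ia; ring: defn.
Qed.

(** The second consistency condition; eliminating n between it and the
    hypothesis of [trace_candidate] produces the cubic equation for t. *)
Lemma norm_candidate a b c t n :
    sqI a = 0 -> t *: a + b \notin sqZ ->
    n * (2 * sqP a b * t + 2 * sqP a c + sqI b) = sqI c ->
  sqI ((t *: a + b)^-1 * (n *: a - c)) = n.
Proof.
move=> Ia uD defIc; rewrite sqI_invM //; apply: (canLR (mulfK uD)).
by rewrite sqI_scaleB sqI_scaleD Ia -defIc; ring.
Qed.

End TraceNorm.

Theorem theorem5p4 (R : realType) (a2 a3 b1 b2 b3 : R) (a b c : splitquat R)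
    (T N : R)
    (ha : a = 1 + a2 *: sqj + a3 *: sqk)
    (ha23 : a2 ^+ 2 + a3 ^+ 2 = 1)
    (hb : b = b1 *: sqi + b2 *: sqj + b3 *: sqk)
    (hb0 : b <> 0)
    (hPab : sqP a b <> 0)
    (hT : 4 * sqP a b ^+ 2 * T ^+ 3
          + (4 * sqP a b * (2 * sqP a c + sqI b)) * T ^+ 2
          + (4 * sqP a b * sqP b c + (2 * sqP a c + sqI b) ^+ 2) * T
          + 2 * sqP b c * (2 * sqP a c + sqI b) - 2 * sqP a b * sqI c = 0)
    (hTab : T *: a + b \notin sqZ)
    (hN : N = (2 * sqP a b * T ^+ 2 + (2 * sqP a c + sqI b) * T + 2 * sqP b c)
              / (2 * sqP a b)) :
  let x := (T *: a + b)^-1 * (N *: a - c) in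
  a * x ^+ 2 + b * x + c = 0.
Proof.
have Ia : sqI a = 0.
  have -> : sqI a = 1 - (a2 ^+ 2 + a3 ^+ 2) by rewrite ha /sqI /sqP /=; ring.
  by rewrite ha23 subrr.
have P2 : 2 * sqP a b != 0.
  by rewrite mulf_neq0 ?Num.Theory.pnatr_eq0 //; apply/eqP.
have defN : 2 * sqP a b * N
    = 2 * sqP a b * T ^+ 2 + (2 * sqP a c + sqI b) * T + 2 * sqP b c.
  by rewrite hN mulrC divfK.
(* Multiplied by 2 P_ab, this equation is the cubic with N substituted. *)
have defIc : N * (2 * sqP a b * T + 2 * sqP a c + sqI b) = sqI c.
  by apply: (mulfI P2); rewrite mulrA defN; apply: subr0_eq; rewrite -[RHS]hT; ring.
move=> x; apply: quadratic_of_linear.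
by rewrite trace_candidate // norm_candidate // mulVKr ?squnitE.
Qed.
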